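(* Let $n\geqslant 2$ be an integer and $0<\varepsilon<\frac{1}{3600\,n^{11}}$. If a group $\mathcal{G}$ of $n\times n$ unitary complex matrices has a weak $\varepsilon$-approximate fixed point, then $\mathcal{G}$ has a common eigenvector.
   Context: $\mathbb{C}^n$ carries the standard inner product and $\|\cdot\|$ is the Euclidean norm. For $0<\varepsilon<1$, a vector $\xi\in\mathbb{C}^n$ with $\|\xi\|=1$ is a weak $\varepsilon$-approximate fixed point of a matrix group $\mathcal{G}\subseteq M_n(\mathbb{C})$ if $|\langle G\xi,\xi\rangle|\geqslant 1-\varepsilon$ for all $G\in\mathcal{G}$. A common eigenvector of $\mathcal{G}$ is a vector $\eta$ with $\|\eta\|=1$ such that for every $G\in\mathcal{G}$ there is a scalar $\lambda\in\mathbb{C}$ with $G\eta=\lambda\eta$. *)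

(* Defs.v *)
From mathcomp Require Import all_boot all_order all_algebra.
From mathcomp Require Import classical_sets reals complex.

Set Implicit Arguments.
Unset Strict Implicit.
Unset Printing Implicit Defensive.

Import Order.TTheory GRing.Theory Num.Theory.
Local Open Scope ring_scope.
Local Open Scope complex_scope.
Local Open Scope classical_set_scope.

(* [dotmx] is the standard inner product on row vectors, linear in its first
   argument; here vectors are columns, so that a matrix [A] acts by [A *m u]. *)
Definition inner (R : realType) (n : nat) (u v : 'cV[R[i]]_n) : R[i] :=
  dotmx u^T v^T.

(* The Euclidean norm, valued in the nonnegative reals of [R[i]].  It is not
   [`|u|], which on matrices is the sup norm. *)
Definition enorm (R : realType) (n : nat) (u : 'cV[R[i]]_n) : R[i] :=
  sqrtC (inner u u).

Definition is_matrix_group (R : realType) (n : nat) (G : set 'M[R[i]]_n) : Prop :=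
  [/\ forall A, G A -> A \in unitmx,
      G 1%:M,
      forall A B, G A -> G B -> G (A *m B)
    & forall A, G A -> G (invmx A)].

(* The inequality is between elements of [R[i]] with zero imaginary part, where
   the order of [R[i]] is that of [R]. *)
Definition is_weak_approx_fixed_point (R : realType) (n : nat)
    (G : set 'M[R[i]]_n) (eps : R) (xi : 'cV[R[i]]_n) : Prop :=
  enorm xi = 1 /\
  forall A, G A -> (1 - eps)%:C <= `|inner (A *m xi) xi|.

Definition is_common_eigenvector (R : realType) (n : nat)
    (G : set 'M[R[i]]_n) (eta : 'cV[R[i]]_n) : Prop :=
  enorm eta = 1 /\
  forall A, G A -> exists lambda : R[i], A *m eta = lambda *: eta.

(* Main.v *)
Require Import Defs.
From mathcomp Require Import all_boot all_order all_algebra.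
From mathcomp Require Import ring lra.
From mathcomp Require Import boolp classical_sets reals complex.

(** Let P be the orthogonal projection onto the line of xi.  The group acts on
    matrices by X |-> A X A^*, which preserves the Hilbert-Schmidt inner product
    <X, Y> = tr (X Y^* ), and the matrices it fixes are those commuting with the
    group.  Approximate fixedness of xi says that P is hardly moved:
    <A P A^*, P> = |<A xi, xi>|^2 >= (1 - eps)^2 for every A.

    Let T be the orthogonal projection of P onto the commutant.  By the mean
    ergodic theorem, T is a limit of averages of the matrices A P A^*, so it
    inherits the bound: s := <T, T> = <T, P> >= (1 - eps)^2 > 1/2
    ([commutant_projection], from [mean_ergodic]).  No invariant integral over
    the group is involved: in finite dimension one averaging operator M has only
    the group-fixed vectors as fixed vectors, and the orthogonal complement of
    these is the image of 1 - M, on which the averages of the powers of M tend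
    to 0 at an explicit rate.

    The commutant is stable under adjoints, so T is Hermitian.  Its largest
    eigenvalue in modulus, d, satisfies |d| >= |<T xi, xi>| = s, while the
    squared moduli of all eigenvalues add up to s.  If d were a multiple
    eigenvalue, then 2 s^2 <= s, that is s <= 1/2.  Hence the eigenspace of d is
    a line ([normal_simple_eigenvector]); the group commutes with T, so it
    preserves this line, which is spanned by a common eigenvector. *)

Set Implicit Arguments.
Unset Strict Implicit.
Unset Printing Implicit Defensive.

Import Order.TTheory GRing.Theory Num.Theory.
Local Open Scope ring_scope.
Local Open Scope complex_scope.
Local Open Scope classical_set_scope.
Local Open Scope sesquilinear_scope.

Local Notation "''[' u , v ]" := (dotmx u v) : ring_scope.
Local Notation "''[' u ]" := (dotmx u u) : ring_scope.

(** * A mean ergodic theorem for semigroups of isometries *)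

Section MeanErgodic.

Variables (C : numClosedFieldType) (N : nat) (H : set 'M[C]_N).

(** The convex combinations of elements of [H] with dyadic coefficients.
    Generating them by midpoints leaves no coefficients to carry around, and
    they suffice to approximate the projection onto the fixed vectors. *)
Inductive dyadic_mean : 'M[C]_N -> Prop :=
| dyadic_mean_elt h of H h : dyadic_mean h
| dyadic_mean_half A B of dyadic_mean A & dyadic_mean B :
    dyadic_mean (2^-1 *: (A + B)).

Lemma half_double (V : lmodType C) (x : V) : 2^-1 *: (x + x) = x.
Proof.
by rewrite -mulr2n -scaler_nat scalerA mulVf ?scale1r // pnatr_eq0.
Qed.

Lemma mulmx_half (u : 'rV[C]_N) (A B : 'M[C]_N) :
  u *m (2^-1 *: (A + B)) = 2^-1 *: (u *m A + u *m B).
Proof. by rewrite -scalemxAr mulmxDr. Qed.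

Lemma dyadic_mean_fixed (u : 'rV[C]_N) A :
  (forall h, H h -> u *m h = u) -> dyadic_mean A -> u *m A = u.
Proof.
move=> uH; elim=> [h /uH //|{}A B _ uA _ uB].
by rewrite mulmx_half uA uB half_double.
Qed.

Lemma dyadic_mean_lower (c : C) (p : 'rV[C]_N) A :
  (forall h, H h -> c <= '[p *m h, p]) -> dyadic_mean A -> c <= '[p *m A, p].
Proof.
move=> pH; elim=> [h /pH //|{}A B _ pA _ pB].
rewrite mulmx_half linearZl_LR linearDl /= -[c](@half_double C^o c).
by rewrite ler_wpM2l ?invr_ge0 ?ler0n // lerD.
Qed.

Hypothesis H_mul : forall g h, H g -> H h -> H (g *m h).

Lemma dyadic_mean_mul A B :
  dyadic_mean A -> dyadic_mean B -> dyadic_mean (A *m B).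
Proof.
move=> + mB; elim=> [h Hh|{}A A' _ AB _ A'B]; last first.
  by rewrite -scalemxAl mulmxDl; apply: dyadic_mean_half.
elim: mB => [g Hg|{}B B' _ hB _ hB'].
  by apply: dyadic_mean_elt; apply: H_mul.
by rewrite -scalemxAr mulmxDr; apply: dyadic_mean_half.
Qed.

Hypothesis H_1 : H 1%:M.

(** The averages S_k of the first 2^k powers of [A], for which (1 - A) S_k
    telescopes to 2^-k (1 - A^(2^k)).  The length 2^k makes them dyadic means,
    as S_(k+1) is the midpoint of S_k and S_k A^(2^k). *)
Lemma dyadic_mean_powers A k : dyadic_mean A ->
  exists S B, [/\ dyadic_mean S, dyadic_mean B &
    (1%:M - A) *m S = (2^-1) ^+ k *: (1%:M - B)].
Proof.
move=> mA; elim: k => [|k [S [B [mS mB eqS]]]].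
  exists 1%:M, A; split=> //; first exact: dyadic_mean_elt.
  by rewrite mulmx1 scale1r.
exists (2^-1 *: (S + S *m B)), (B *m B); split; last 1 first.
- rewrite -scalemxAr mulmxDr mulmxA eqS -scalemxAl -scalerDr scalerA -exprS.
  by rewrite mulmxBl mul1mx addrA subrK.
- by apply: dyadic_mean_half => //; apply: dyadic_mean_mul.
- exact: dyadic_mean_mul.
Qed.

Hypothesis H_isometry :
  forall h, H h -> forall u v : 'rV[C]_N, '[u *m h, v *m h] = '[u, v].

Lemma parallelogram (x y : 'rV[C]_N) :
  '[x + y] + '[x - y] = '[x] *+ 2 + '[y] *+ 2.
Proof.
rewrite dnormD dnormB /=; ring.
Qed.

Lemma dyadic_mean_contraction (u : 'rV[C]_N) A :
  dyadic_mean A -> '[u *m A] <= '[u].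
Proof.
elim=> [h Hh|{}A B _ leA _ leB]; first by rewrite H_isometry.
rewrite mulmx_half dnormZ -(ler_pM2l (_ : 0 < 2 ^+ 2 :> C)) ?exprn_gt0 //.
rewrite mulrA -exprMn normfV normr_nat divff ?pnatr_eq0 // expr1n mul1r.
apply: (@le_trans _ _ ('[u *m A + u *m B] + '[u *m A - u *m B])).
  by rewrite lerDl dnorm_ge0.
rewrite parallelogram (_ : 2 ^+ 2 * '[u] = '[u] *+ 2 + '[u] *+ 2).
  by rewrite lerD // lerMn2r.
by ring.
Qed.

(** Strict convexity of the Euclidean ball: if the midpoint of two vectors of
    norm at most |u| is [u], then both are [u]. *)
Lemma dyadic_mean_half_fixed (u : 'rV[C]_N) A B :
    dyadic_mean A -> dyadic_mean B -> u *m (2^-1 *: (A + B)) = u ->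
  u *m A = u /\ u *m B = u.
Proof.
move=> mA mB; rewrite mulmx_half => eqAB.
suff eqA : u *m A = u *m B by move: eqAB; rewrite eqA half_double.
have sumE : u *m A + u *m B = u *+ 2.
  by rewrite -[u in RHS]eqAB -scaler_nat scalerA divff ?scale1r // pnatr_eq0.
apply/eqP; rewrite -subr_eq0 -(dnorm_eq0 (@dotmx C N)) eq_le dnorm_ge0 andbT /=.
have := parallelogram (u *m A) (u *m B).
rewrite sumE -scaler_nat dnormZ normr_nat => /(canRL (addKr _)) ->.
rewrite addrC subr_le0 (_ : 2 ^+ 2 * '[u] = '[u] *+ 2 + '[u] *+ 2).
  by rewrite lerD // lerMn2r dyadic_mean_contraction ?orbT.
by ring.
Qed.

Lemma dyadic_mean_orthogonal (u f : 'rV[C]_N) A :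
  (forall h, H h -> f *m h = f) -> dyadic_mean A -> '[u *m A, f] = '[u, f].
Proof.
move=> fH; elim=> [h Hh|{}A B _ uA _ uB].
  by rewrite -[in LHS](fH h Hh) H_isometry.
rewrite mulmx_half linearZl_LR linearDl /= uA uB.
exact: (@half_double C^o).
Qed.

(** A mean [A] for which ker (1 - A) has least dimension does it: replacing [A]
    by its midpoint with an element [h] of [H] intersects this kernel with the
    vectors fixed by [h], so by minimality all of it is fixed by [h]. *)
Lemma exists_mean_detecting_fixed : exists2 A, dyadic_mean A &
  forall u : 'rV[C]_N, u *m A = u -> forall h, H h -> u *m h = u.
Proof.
pose rk k := `[< exists2 A, dyadic_mean A & \rank (1%:M - A) = k >].
have exrk : exists k, rk k.
  exists (\rank (1%:M - 1%:M : 'M[C]_N)); apply/asboolP.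
  by exists 1%:M => //; apply: dyadic_mean_elt.
have lerk k : rk k -> (k <= N)%N by case/asboolP=> A _ <-; apply: rank_leq_row.
case: (ex_maxnP exrk lerk) => k /asboolP[A mA rkA] max_k.
exists A => // u uA h Hh; have mh : dyadic_mean h by apply: dyadic_mean_elt.
pose B := 2^-1 *: (A + h); have mB : dyadic_mean B by apply: dyadic_mean_half.
have kerBA : (kermx (1%:M - B) <= kermx (1%:M - A))%MS.
  apply/rV_subP => v /sub_kermxP; rewrite mulmxBr mulmx1 => /eqP.
  rewrite subr_eq0 eq_sym => /eqP /(dyadic_mean_half_fixed mA mh)[vA _].
  by apply/sub_kermxP; rewrite mulmxBr mulmx1 vA subrr.
have kerAB : (kermx (1%:M - A) <= kermx (1%:M - B))%MS.
  rewrite -(mxrank_leqif_sup kerBA) eqn_leq mxrankS //=.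
  rewrite !mxrank_ker leq_sub2l // rkA; apply: max_k; apply/asboolP.
  by exists B.
have /submx_trans/(_ kerAB) : (u <= kermx (1%:M - A))%MS.
  by apply/sub_kermxP; rewrite mulmxBr mulmx1 uA subrr.
move/sub_kermxP; rewrite mulmxBr mulmx1 => /eqP.
by rewrite subr_eq0 eq_sym => /eqP /(dyadic_mean_half_fixed mA mh)[].
Qed.

Hypothesis archC : Num.archimedean_axiom C.

(** The vector [t] is the orthogonal projection of [p] onto the fixed vectors.
    The last clause replaces the usual convergence of averages: a lower bound on
    the real numbers <p h, p> passes to the limit <t, p> = <t, t>. *)
Theorem mean_ergodic (p : 'rV[C]_N) : exists t : 'rV[C]_N,
  [/\ forall h, H h -> t *m h = t,
      forall f, (forall h, H h -> f *m h = f) -> '[p - t, f] = 0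
    & forall c : C, (forall h, H h -> c <= '[p *m h, p]) -> c <= '[t]].
Proof.
(* The space is the orthogonal sum of ker (1 - A) and the image of 1 - A. *)
have [A mA fixA] := exists_mean_detecting_fixed.
pose K := kermx (1%:M - A).
have K_fixed (u : 'rV_N) : (u <= K)%MS -> forall h, H h -> u *m h = u.
  move/sub_kermxP; rewrite mulmxBr mulmx1 => /eqP.
  by rewrite subr_eq0 eq_sym => /eqP; apply: fixA.
have im_orth (y f : 'rV_N) : (forall h, H h -> f *m h = f) ->
    '[y *m (1%:M - A), f] = 0.
  move=> fH; rewrite mulmxBr mulmx1 linearBl /= dyadic_mean_orthogonal //.
  by rewrite subrr.
have capK : (K :&: (1%:M - A) = 0)%MS.
  apply/eqP/rowV0Pn => -[v]; rewrite sub_capmx => /andP[vK /submxP[y vy]].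
  rewrite -(dnorm_eq0 (@dotmx C N)) /= {1}vy im_orth ?eqxx //.
  exact: K_fixed.
have fullK : (p <= K + (1%:M - A))%MS.
  apply: submx_full; rewrite /row_full mxrank_disjoint_sum //.
  by rewrite mxrank_ker subnK ?rank_leq_row.
have [[u y] /= pE] := sub_addsmxP fullK.
pose t := u *m K; have tH : forall h, H h -> t *m h = t.
  by apply: K_fixed; apply: submxMl.
have ptE : p - t = y *m (1%:M - A) by rewrite pE addrC addKr.
exists t; split=> // [f fH|c p_lower]; first by rewrite ptE im_orth.
have tpE : '[t, p] = '[t].
  apply/eqP; rewrite -subr_eq0 -linearBr /= hermC /= ptE im_orth //.
  by rewrite rmorph0 mulr0.
have c_real : c \is Num.real.
  by rewrite (ler_real (p_lower _ H_1)) mulmx1 ger0_real ?dnorm_ge0.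
rewrite real_leNgt ?(ger0_real (dnorm_ge0 _ _)) //; apply/negP => lt_tc.
have gap_gt0 : 0 < c - '[t] by rewrite subr_gt0.
pose M := sqrtC '[y] * sqrtC '[p] *+ 2.
(* Averaging over 2^k powers bounds the gap by M / 2^k, for every k. *)
have le_M k : 2 ^+ k * (c - '[t]) <= M.
  have [S [B [mS mB eqS]]] := dyadic_mean_powers k mA.
  have pSE : '[p *m S, p] = '[t] + 2^-1 ^+ k * ('[y, p] - '[y *m B, p]).
    rewrite -[p in p *m S](subrK t) mulmxDl (dyadic_mean_fixed tH mS) ptE.
    rewrite -mulmxA eqS -scalemxAr mulmxBr mulmx1 linearDl /= tpE addrC.
    by rewrite linearZl_LR linearBl.
  have := dyadic_mean_lower p_lower mS.
  rewrite pSE -lerBlDl -(ler_pM2l (_ : 0 < 2 ^+ k)) ?exprn_gt0 // mulrA.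
  rewrite -exprMn divff ?pnatr_eq0 // expr1n mul1r => le_z.
  have gap2_gt0 := mulr_gt0 (exprn_gt0 k (ltr0Sn C 1)) gap_gt0.
  have z_ge0 := le_trans (ltW gap2_gt0) le_z.
  apply: le_trans le_z _; rewrite -(ger0_norm z_ge0).
  apply: le_trans (ler_normB _ _) _; rewrite /M mulr2n lerD //.
    exact: (CauchySchwarz_sqrt (@dotmx C N)).
  apply: le_trans (CauchySchwarz_sqrt (@dotmx C N) _ _) _.
  by rewrite ler_wpM2r ?sqrtC_ge0 ?dnorm_ge0 // ler_sqrtC ?nnegrE ?dnorm_ge0
    // dyadic_mean_contraction.
have [k] := archC (M / (c - '[t])).
have M_ge0 : 0 <= M by rewrite mulrn_wge0 // mulr_ge0 ?sqrtC_ge0 ?dnorm_ge0.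
rewrite ger0_norm ?divr_ge0 ?(ltW gap_gt0) // ltr_pdivrMr // => lt_M.
have /le_trans/(_ (le_M k)) : k%:R * (c - '[t]) <= 2 ^+ k * (c - '[t]).
  by rewrite ler_pM2r // -natrX ler_nat ltnW // ltn_expl.
by rewrite (lt_geF lt_M).
Qed.
End MeanErgodic.

(** * The projection onto the commutant *)

Lemma dotmx_mxvec (C : numClosedFieldType) m n (X Y : 'M[C]_(m, n)) :
  '[mxvec X, mxvec Y] = \tr (X *m Y^t*).
Proof.
rewrite dotmxE mxE (reindex _ (curry_mxvec_bij _ _)) /= /mxtrace.
under [RHS]eq_bigr do rewrite mxE.
rewrite pair_bigA /=; apply: eq_bigr => -[i j] _ /=.
by rewrite !mxE mxvecE (mxvecE Y).
Qed.

Lemma mxtrace_adj (C : numClosedFieldType) n (X : 'M[C]_n) :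
  \tr (X^t*) = Num.conj (\tr X).
Proof. by rewrite rmorph_sum; apply: eq_bigr => i _; rewrite !mxE. Qed.

Section Conjugation.

Variables (C : numClosedFieldType) (n : nat).

Definition conjugation_mx (A : 'M[C]_n) : 'M[C]_(n * n) :=
  lin_mx (mulmxr (A^t*) \o mulmx A).

Lemma mul_conjugation_mx (A X : 'M[C]_n) :
  mxvec X *m conjugation_mx A = mxvec (A *m X *m A^t*).
Proof. by rewrite mul_vec_lin. Qed.

Lemma eq_on_mxvec (M M' : 'M[C]_(n * n)) :
  (forall X : 'M[C]_n, mxvec X *m M = mxvec X *m M') -> M = M'.
Proof.
move=> eqM; apply/row_matrixP => i; rewrite !rowE.
by rewrite -[delta_mx _ _]vec_mxK eqM.
Qed.

Lemma conjugation_mx1 : conjugation_mx 1%:M = 1%:M.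
Proof.
apply: eq_on_mxvec => X.
by rewrite mul_conjugation_mx trmx1 map_mx1 !mulmx1 mul1mx.
Qed.

Lemma conjugation_mxM (A B : 'M[C]_n) :
  conjugation_mx A *m conjugation_mx B = conjugation_mx (B *m A).
Proof.
apply: eq_on_mxvec => X; rewrite mulmxA !mul_conjugation_mx.
by rewrite trmx_mul map_mxM !mulmxA.
Qed.

Lemma conjugation_mx_isometry (A : 'M[C]_n) (u v : 'rV[C]_(n * n)) :
  A \is unitarymx -> '[u *m conjugation_mx A, v *m conjugation_mx A] = '[u, v].
Proof.
move=> A_unitary; rewrite -[u]vec_mxK -[v]vec_mxK !mul_conjugation_mx.
rewrite !dotmx_mxvec !trmx_mul !map_mxM trmxCK !mulmxA.
by rewrite mulmxKtV // -!mulmxA mxtrace_mulC !mulmxA mulmxKtV.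
Qed.

Lemma conjugation_fixed_comm (A X : 'M[C]_n) : A \is unitarymx ->
  mxvec X *m conjugation_mx A = mxvec X <-> A *m X = X *m A.
Proof.
move=> A_unitary; rewrite mul_conjugation_mx.
split=> [/(can_inj mxvecK) eqX|->].
  by rewrite -[in RHS]eqX mulmxKtV.
by rewrite mulmxtVK.
Qed.

(** [T] is the orthogonal projection of [P] onto the commutant of [G]; the
    commutant is the space of fixed points of conjugation by [G]. *)
Theorem commutant_projection (G : set 'M[C]_n) (P : 'M[C]_n) :
    Num.archimedean_axiom C -> G 1%:M ->
    (forall A B, G A -> G B -> G (A *m B)) ->
    (forall A, G A -> A \is unitarymx) -> (forall A, G A -> G (invmx A)) ->
    P^t* = P ->
  exists T : 'M[C]_n, [/\ T^t* = T, forall A, G A -> A *m T = T *m A,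
    \tr (P *m T) = \tr (T *m T) &
    forall c, (forall A, G A -> c <= \tr (A *m P *m A^t* *m P)) ->
      c <= \tr (T *m T)].
Proof.
move=> archC G1 GM Gu GV Padj.
pose H : set 'M[C]_(n * n) := [set M | exists2 A, G A & M = conjugation_mx A].
have H_1 : H 1%:M by exists 1%:M; rewrite ?conjugation_mx1.
have H_mul g h : H g -> H h -> H (g *m h).
  move=> [A GA ->] [B GB ->]; exists (B *m A); last by rewrite conjugation_mxM.
  exact: GM.
have H_iso h : H h -> forall u v : 'rV_(n * n), '[u *m h, v *m h] = '[u, v].
  by move=> [A GA ->] u v; apply/conjugation_mx_isometry/Gu.
have [t [tH orth lower]] := mean_ergodic H_mul H_1 H_iso archC (mxvec P).
pose T := vec_mx t; have tE : t = mxvec T by rewrite vec_mxK.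
have comm_fixed X : (forall A, G A -> A *m X = X *m A) ->
    forall h, H h -> mxvec X *m h = mxvec X.
  by move=> XG _ [A GA ->]; apply/(conjugation_fixed_comm _ (Gu _ GA))/XG.
have commT A : G A -> A *m T = T *m A.
  move=> GA; apply/(conjugation_fixed_comm _ (Gu _ GA)).
  by rewrite -tE; apply: tH; exists A.
have orthT X : (forall A, G A -> A *m X = X *m A) ->
    \tr (P *m X^t*) = \tr (T *m X^t*).
  move=> /comm_fixed /orth; rewrite tE -linearB /= dotmx_mxvec mulmxBl linearB.
  by move/eqP; rewrite subr_eq0 => /eqP.
have commTadj A : G A -> A *m T^t* = T^t* *m A.
  move=> GA; have Au := Gu _ GA.
  have : (invmx A *m T)^t* = (T *m invmx A)^t* by rewrite commT //; apply: GV.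
  rewrite !trmx_mul !map_mxM invmx_unitary // trmxCK. exact: esym.
have commF A : G A -> A *m (T - T^t*) = (T - T^t*) *m A.
  by move=> GA; rewrite mulmxBr mulmxBl commT ?commTadj.
(* The commutant contains F = T - T^*.  As P is Hermitian, both T and T^* have
   the same inner product with F as P, so F is orthogonal to itself. *)
have Tadj : T^t* = T.
  pose F := T - T^t*.
  have Fadj : F^t* = - F by rewrite /F linearB /= map_mxB trmxCK opprB.
  have trTF : \tr (P *m F) = \tr (T *m F).
    by have := orthT F commF; rewrite Fadj !mulmxN !linearN => /oppr_inj.
  have trTadjF : \tr (P *m F) = \tr (T^t* *m F).
    apply: (can_inj (@conjCK C)); rewrite -!mxtrace_adj !trmx_mul !map_mxM.
    rewrite trmxCK Padj Fadj !mulNmx !linearN /= mxtrace_mulC trTF.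
    by rewrite mxtrace_mulC.
  apply/eqP; rewrite eq_sym -subr_eq0 -(can_eq mxvecK) linear0.
  rewrite -(dnorm_eq0 (@dotmx C _)) /= dotmx_mxvec -/F Fadj mulmxN linearN /=.
  by rewrite {1}/F mulmxBl linearB /= -trTF -trTadjF subrr oppr0.
exists T; split=> //; first by rewrite -{1}Tadj orthT // Tadj.
move=> c cP.
have -> : \tr (T *m T) = '[t] by rewrite tE dotmx_mxvec Tadj.
apply: lower => _ [A GA ->].
by rewrite mul_conjugation_mx dotmx_mxvec Padj cP.
Qed.

End Conjugation.

(** * A simple eigenvalue of a normal matrix *)

Lemma mxtrace_conjugate (C : numClosedFieldType) n (V X : 'M[C]_n) :
  V \is unitarymx -> \tr (invmx V *m X *m V) = \tr X.
Proof.
move=> /unitarymx_unit V_unit; rewrite mxtrace_mulC mulmxA mulmxV //.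
by rewrite mul1mx.
Qed.

Lemma dotmx_tr (C : numClosedFieldType) n (u v : 'cV[C]_n) :
  '[u^T, v^T] = (v^t* *m u) 0 0.
Proof.
by rewrite dotmxE !mxE; apply: eq_bigr => i _; rewrite !mxE mulrC.
Qed.

Lemma dotmx_tr_norm (C : numClosedFieldType) n (u : 'cV[C]_n) :
  '[u^T] = \sum_i `|u i 0| ^+ 2.
Proof.
by rewrite dotmx_tr mxE; apply: eq_bigr => i _; rewrite !mxE mulrC normCK.
Qed.

Lemma dotmx_tr_unitary (C : numClosedFieldType) n (V : 'M[C]_n)
    (u v : 'cV[C]_n) :
  V \is unitarymx -> '[(V *m u)^T, (V *m v)^T] = '[u^T, v^T].
Proof.
move=> V_unitary.
by rewrite !dotmx_tr trmx_mul map_mxM mulmxA mulmxKtV.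
Qed.

(** The trace of T T^* is the sum of the squared moduli of the eigenvalues of
    [T], and |<T xi, xi>| is at most the largest of these moduli, say |d|.  A
    second eigenvalue equal to [d] would give 2 s^2 <= 2 |d|^2 <= s for
    s := tr (T T^* ) > 1/2.  So the eigenspace of [d] is a line, which every
    matrix commuting with [T] preserves. *)
Theorem normal_simple_eigenvector (C : numClosedFieldType) n (T : 'M[C]_n)
    (xi : 'cV[C]_n) : T \is normalmx -> '[xi^T] = 1 ->
    2^-1 < \tr (T *m T^t*) -> \tr (T *m T^t*) <= `|'[(T *m xi)^T, xi^T]| ->
  exists2 eta : 'cV[C]_n, '[eta^T] = 1 &
    forall A, A *m T = T *m A -> exists lambda, A *m eta = lambda *: eta.
Proof.
case: n => [|n] in T xi *.
  by move=> _ _; rewrite /mxtrace big_ord0 invr_lt0 ltrn0.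
move=> T_normal xi1 gt_half le_dot.
pose V := spectralmx T; pose d := spectral_diag T.
have V_unitary : V \is unitarymx := spectral_unitarymx T.
have V_unit := unitarymx_unit V_unitary.
have TE : T = invmx V *m diag_mx d *m V := orthomx_spectralP T_normal.
have VTE : V *m T = diag_mx d *m V by rewrite [in LHS]TE -mulmxA mulKVmx.
pose y := V *m xi.
have trE : \tr (T *m T^t*) = \sum_i `|d 0 i| ^+ 2.
  rewrite TE !trmx_mul !map_mxM !mulmxA invmx_unitary // trmxCK.
  rewrite mulmxtVK // -invmx_unitary // -[invmx V *m _ *m _]mulmxA.
  rewrite mxtrace_conjugate //.
  rewrite tr_diag_mx map_diag_mx mulmx_diag mxtrace_diag.
  by apply: eq_bigr => i _; rewrite !mxE normCK.
have y1 : \sum_i `|y i 0| ^+ 2 = 1.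
  by rewrite -dotmx_tr_norm dotmx_tr_unitary.
have dotE : '[(T *m xi)^T, xi^T] = \sum_i d 0 i * `|y i 0| ^+ 2.
  rewrite -(dotmx_tr_unitary _ _ V_unitary) mulmxA VTE -mulmxA -/y.
  rewrite dotmx_tr mul_diag_mx mxE; apply: eq_bigr => i _.
  by rewrite !mxE normCK; ring.
have [i0 _ max_i0] : extremum_spec >=%R predT (fun i => `|d 0 i|)
    [arg max_(i > ord0 | true) `|d 0 i|]%O.
  by apply: real_arg_maxP => // i _; rewrite realE normr_ge0.
set s := \tr _ in gt_half le_dot trE.
have s_le : s <= `|d 0 i0|.
  apply: le_trans le_dot _; rewrite dotE.
  apply: le_trans (ler_norm_sum _ _ _) _.
  rewrite -[leRHS]mulr1 -y1 mulr_sumr; apply: ler_sum => i _.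
  rewrite normrM [X in _ * X]ger0_norm ?exprn_ge0 //.
  by rewrite ler_wpM2r ?exprn_ge0 //; apply: max_i0.
have s_gt0 : 0 < s by apply: lt_trans gt_half; rewrite invr_gt0.
have simple j : d 0 j = d 0 i0 -> j = i0.
  move=> dj; apply/eqP/negPn/negP => ne_j.
  have : s ^+ 2 *+ 2 <= s.
    rewrite [leRHS]trE (bigD1 i0) //= (bigD1 j) //= addrA dj -mulr2n.
    apply: ler_wpDr; first by apply: sumr_ge0 => i _; rewrite exprn_ge0.
    by rewrite lerMn2r /= lerXn2r ?nnegrE // ltW.
  rewrite -mulr_natl expr2 mulrA -[leRHS]mul1r ler_pM2r //.
  by rewrite -ler_pdivlMl ?ltr0n // mulr1 (lt_geF gt_half).
pose eta := V^t* *m delta_mx i0 (0 : 'I_1).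
have VetaE : V *m eta = delta_mx i0 0.
  by rewrite mulmxA (unitarymxP V_unitary) mul1mx.
exists eta.
  rewrite -(dotmx_tr_unitary _ _ V_unitary) VetaE dotmx_tr_norm.
  rewrite (bigD1 i0) //= big1 ?addr0 => [|i ne_i].
    by rewrite mxE !eqxx normr1 expr1n.
  by rewrite mxE (negPf ne_i) normr0 expr0n.
move=> A AT; pose z := V *m (A *m eta).
have DdeltaE : diag_mx d *m delta_mx i0 (0 : 'I_1) = d 0 i0 *: delta_mx i0 0.
  rewrite mul_diag_mx; apply/matrixP => i j; rewrite !mxE.
  by case: eqP => [->//|_]; rewrite !mulr0.
(* In the eigenbasis [A *m eta] has coordinates [z]; it is again an eigenvector
   of [T] for the simple eigenvalue [d 0 i0]. *)
have DzE : diag_mx d *m z = d 0 i0 *: z.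
  rewrite /z [LHS]mulmxA -VTE -[LHS]mulmxA [T *m (A *m _)]mulmxA -AT.
  rewrite -(mulmxA A).
  suff -> : T *m eta = d 0 i0 *: eta by rewrite -!scalemxAr.
  by rewrite TE -!mulmxA VetaE DdeltaE -scalemxAr invmx_unitary.
have zE : z = z i0 0 *: delta_mx i0 0.
  apply/matrixP => i j; rewrite !mxE !ord1 andbT.
  have [->|ne_i] := eqVneq i i0; first by rewrite mulr1.
  rewrite mulr0; move/matrixP/(_ i 0): DzE.
  rewrite mul_diag_mx !mxE => /eqP; rewrite -subr_eq0 -mulrBl mulf_eq0.
  rewrite subr_eq0 => /orP[/eqP/simple eq_i|/eqP //].
  by rewrite eq_i eqxx in ne_i.
exists (z i0 0).
rewrite scalemxAr -zE /z [RHS]mulmxA.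
by rewrite -[in RHS]invmx_unitary // mulVmx // mul1mx.
Qed.

(** * The common eigenvector *)

Lemma complex_archimedean (R : realType) : Num.archimedean_axiom R[i].
Proof.
move=> x; rewrite normc_def.
set r := Num.sqrt _; exists (Num.Def.archi_bound r).
by rewrite -(rmorph_nat (real_complex R)) ltcR archi_boundP ?sqrtr_ge0.
Qed.

Theorem theorem8p1 (R : realType) (n : nat) (eps : R) (G : set 'M[R[i]]_n)
  (hn : (2 <= n)%N)
  (eps_gt0 : 0 < eps) (eps_lt : eps < 1 / (3600%:R * n%:R ^+ 11))
  (G_group : is_matrix_group G)
  (G_unitary : forall A, G A -> A \is unitarymx)
  (G_fixed : exists xi : 'cV[R[i]]_n, is_weak_approx_fixed_point G eps xi) :
  exists eta : 'cV[R[i]]_n, is_common_eigenvector G eta.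
Proof.
have [_ G1 GM GV] := G_group; have [xi [xi_norm xi_fixed]] := G_fixed.
have enorm1 (u : 'cV[R[i]]_n) : enorm u = 1 <-> '[u^T] = 1.
  rewrite /enorm /inner; split=> [/(congr1 (fun x => x ^+ 2))|->].
    by rewrite sqrtCK expr1n.
  by rewrite sqrtC1.
have xi1 := (enorm1 xi).1 xi_norm.
pose P := xi *m xi^t*.
have Padj : P^t* = P by rewrite trmx_mul map_mxM trmxCK.
have trP X : \tr (X *m P) = '[(X *m xi)^T, xi^T].
  by rewrite dotmx_tr mulmxA mxtrace_mulC /mxtrace big_ord1.
have [T [Tadj commT trPT lower]] :=
  commutant_projection (@complex_archimedean R) G1 GM G_unitary GV Padj.
have T_normal : T \is normalmx by apply/normalmxP; rewrite Tadj.
have eps_half : eps < 4^-1.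
  apply: lt_le_trans eps_lt _.
  rewrite div1r lef_pV2 ?posrE ?mulr_gt0 ?exprn_gt0 ?ltr0n ?(ltnW hn) //.
  rewrite -natrX -natrM ler_nat -[4%N]muln1 leq_mul // expn_gt0.
  by rewrite (ltnW hn).
have gt_half : 2^-1 < \tr (T *m T^t*).
  apply: lt_le_trans (_ : ((1 - eps) ^+ 2)%:C <= _).
    rewrite -[X in X < _](_ : (2^-1 : R)%:C = _); last first.
      by rewrite fmorphV rmorph_nat.
    by rewrite ltcR; nra.
  rewrite Tadj; apply: lower => A GA.
  pose w := xi^t* *m (A *m xi).
  have -> : \tr (A *m P *m A^t* *m P) = `|inner (A *m xi) xi| ^+ 2.
    rewrite trP /inner !dotmx_tr -/w.
    have -> : xi^t* *m (A *m P *m A^t* *m xi) = w *m w^t*.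
      by rewrite /w !trmx_mul !map_mxM trmxCK !mulmxA.
    by rewrite mxE big_ord1 normCK !mxE.
  rewrite rmorphXn lerXn2r ?nnegrE //=; last exact: xi_fixed.
  by rewrite lecR; lra.
have [|eta eta1 etaP] := normal_simple_eigenvector T_normal xi1 gt_half.
  rewrite -trP (mxtrace_mulC T P) trPT Tadj ger0_norm //.
  by rewrite -{2}Tadj ltW // (lt_trans _ gt_half) // invr_gt0.
exists eta; split; first exact/enorm1.
by move=> A GA; apply/etaP/commT.
Qed.
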